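(* Let $l\ge 2$, $k>l$ and $m\ge 2$ be integers with $2k\neq ml$. Then, as $n\to\infty$, $$ex(n,C_{ml},\{C_3,C_4,\dots,C_{2l-1}\}\cup\{C_{2k}\})=\Theta(n^m).$$
   Context: $C_k$ denotes the cycle with $k$ vertices. For a graph $H$ and a family of graphs $\mathcal F$, $ex(n,H,\mathcal F)$ is the maximum number of subgraphs isomorphic to $H$ in an $n$-vertex graph containing no member of $\mathcal F$ as a subgraph. *)

(* Defs.v *)
From mathcomp Require Import all_boot all_order all_algebra.
Set Implicit Arguments. Unset Strict Implicit. Unset Printing Implicit Defensive.

Definition is_graph n (E : {set {set 'I_n}}) : bool :=
  [forall e in E, #|e| == 2].

Definition cyc_edges n j (f : {ffun 'I_j -> 'I_n}) : {set {set 'I_n}} :=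
  [set [set f i; f (ordS i)] | i : 'I_j].

Definition is_cycle_copy n j (S : {set {set 'I_n}}) : bool :=
  [exists f : {ffun 'I_j -> 'I_n}, injectiveb f && (S == cyc_edges f)].

Definition count_cycles n j (E : {set {set 'I_n}}) : nat :=
  #|[set S in powerset E | is_cycle_copy j S]|.

Definition has_cycle n j (E : {set {set 'I_n}}) : bool :=
  [exists f : {ffun 'I_j -> 'I_n}, injectiveb f && (cyc_edges f \subset E)].

(* E contains no cycle whose length lies in the family F (lengths >= 3).
   Cycles longer than n cannot occur in an n-vertex graph. *)
Definition cycle_free n (F : pred nat) (E : {set {set 'I_n}}) : bool :=
  ~~ [exists j : 'I_n.+1, F j && has_cycle j E].

Definition ex_cycle (n h : nat) (F : pred nat) : nat :=
  \max_(E : {set {set 'I_n}} | is_graph E && cycle_free F E) count_cycles h E.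

Definition fam (l k : nat) : pred nat :=
  fun j => ((3 <= j) && (j <= 2 * l - 1)) || (j == 2 * k).

(* Main.v *)
Require Import Defs.
From mathcomp Require Import all_boot all_order all_algebra.
From mathcomp Require Import zify.
Set Implicit Arguments.
Unset Strict Implicit.

(** Upper bound. Let f(u,v) be the number of paths of length l from u to v. A copy
    of C_ml is cut by m of its vertices into m paths of length l, so the number of
    copies is at most tr f^m, and (tr f^m)^2 <= (sum f^2)^m; it suffices to prove
    sum f^2 = O(n^2). By the girth condition distinct paths of length l with the
    same ends are internally disjoint. The sum of f is O(n^2), since for each u the
    graph between the spheres of radius l-1 and l around u is sparse, as a
    subgraph of large minimum degree would yield a C_2k. The sum of f(f-1) counts
    pairs P, Q of paths from u to v. Fix 0 < t < l. If f(P_t, Q_(l-t)) is bounded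
    then re-splitting the 2l-cycle PQ at this antipodal pair shows that there are
    O(n^2) such pairs. If both f(P_t, Q_(l-t)) and f(Q_t, P_(l-t)) are large,
    consider this relation on the paths from u to v: a long chain P, Q, ... would
    yield a C_2k by jumping from P_t to Q_(l-t) and so on along new paths of length
    l, hence the relation has only O(f(u,v)) pairs.

    Lower bound. Place m hubs around a circle, and join consecutive ones by
    Theta(n) internally disjoint paths of length l. A cycle that never turns back
    has length ml, any other has length 2l. *)

(** * Paths with fixed ends in graphs of large girth *)

Section Links.
Variables (T : finType) (e : rel T).
Hypothesis e_sym : symmetric e.

(* [p] lists the interior vertices only. *)
Definition link u v p := path e u (rcons p v) && uniq (u :: rcons p v).

Lemma link_rev u v p : link u v (rev p) = link v u p.
Proof.
have E : u :: rcons (rev p) v = rev (v :: rcons p u) by rewrite rev_cons rev_rcons.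
rewrite /link E rev_uniq; congr (_ && _).
have := rev_path e v (rcons p u); rewrite last_rcons belast_rcons rev_cons => ->.
by apply: eq_path => x y; rewrite /= e_sym.
Qed.

Lemma link_nil u v : link u v [::] = e u v && (u != v).
Proof. by rewrite /link /= inE !andbT. Qed.

Lemma link_cat u v p x q :
  link u v (p ++ x :: q) ->
  [/\ link u x p, link x v q & ~~ has (mem (u :: p)) (x :: rcons q v)].
Proof.
rewrite /link rcons_cat -cat_cons cat_path cat_uniq /=.
case/andP=> /and3P[pp ex pq] /and3P[/andP[up Up] nh /andP[xq Uq]].
move: (nh); rewrite negb_or inE negb_or => /andP[/andP[xu xp] _].
split; [|by rewrite /link pq /= xq|by move: nh; rewrite inE !negb_or -andbA].
  by rewrite /link rcons_path pp ex /= rcons_uniq mem_rcons inE negb_or eq_sym xu up xp.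

Qed.

Lemma link_neq u v p : link u v p -> u != v.
Proof. by case/andP=> _ /=; rewrite mem_rcons inE negb_or; case/andP => /andP[]. Qed.

Lemma link_notin_l u v p : link u v p -> u \notin p.
Proof. by case/andP=> _ /=; rewrite mem_rcons inE negb_or; case/andP => /andP[]. Qed.

Lemma link_notin_r u v p : link u v p -> v \notin p.
Proof. by case/andP=> _ /=; rewrite rcons_uniq => /and3P[]. Qed.

Lemma link_uniq u v p : link u v p -> uniq p.
Proof. by case/andP=> _ /=; rewrite rcons_uniq => /and3P[]. Qed.

Lemma link_path u v p : link u v p -> path e u (rcons p v).
Proof. by case/andP. Qed.

Lemma ucycle_links u v p q :
  ucycle e (u :: p ++ v :: rev q) <->
  [/\ link u v p, link u v q & ~~ has (mem q) p].
Proof.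
set c := u :: _; have E : cycle e c && uniq c =
   [&& path e u (rcons p v), path e v (rcons (rev q) u) & uniq ((u :: p) ++ v :: rev q)].
  by rewrite /c /= rcons_cat cat_path /= (rcons_path _ _ p) -!andbA.
rewrite /ucycle E cat_uniq /= !rev_uniq mem_rev has_rev negb_or; split.
  case/and3P=> pp pq /and4P[/andP[up Up] /andP[]].
  rewrite inE negb_or => /andP[vu vp] hq vq Uq.
  have nuq : u \notin q by apply/negP => uq; case/hasP: hq; exists u; rewrite ?inE ?eqxx.
  split.
  - by rewrite /link pp /= rcons_uniq mem_rcons inE negb_or eq_sym vu up vp.
  - rewrite -link_rev /link pq /= rcons_uniq mem_rcons inE negb_or vu !mem_rev rev_uniq.
    by rewrite vq nuq.
  - by apply: contra hq => /hasP[x xp xq]; apply/hasP; exists x; rewrite ?inE ?xp ?orbT.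
case=> lp lq hpq.
rewrite (link_path lp); move: (lq); rewrite -link_rev => /link_path ->.
rewrite inE negb_or eq_sym (link_neq lp) (link_notin_r lp) (link_notin_l lp) (link_uniq lp).
rewrite (link_notin_r lq) (link_uniq lq) /= andbT.
apply/hasPn => x xq /=; rewrite inE negb_or; apply/andP; split.
  by apply: contraNneq (link_notin_l lq) => <-.
by apply: contra hpq => xp; apply/hasP; exists x.
Qed.

(** If the links meet, follow [p] to its first vertex on [q]: the two initial segments form a cycle,
    unless both are empty, and then the argument restarts from the common next vertex. The
    subtracted [has] records that meeting links give a shorter cycle. *)
Lemma two_links_cycle u v p q : link u v p -> link u v q -> p != q ->
  exists2 c, ucycle e c & 3 <= size c <= size p + size q + 2 - has (mem q) p.
Proof.
have [n] := ubnP (size p); elim: n u p q => // n IH u p q le_n lp lq neq.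
case: (boolP (has (mem q) p)) => [hpq|hpq]; last first.
  exists (u :: p ++ v :: rev q); first exact/ucycle_links.
  rewrite /= size_cat /= size_rev; case: p q neq {le_n lp lq hpq} => [|x p] [|y q] //=; lia.
case/split_find: (hpq) le_n lp lq neq => x p1 p2 /= xq hp1.
case/splitPr: xq hp1 => q1 q2 hp1.
rewrite cat_rcons => le_n lp lq neq.
have [lp1 lp2 _] := link_cat lp; have [lq1 lq2 _] := link_cat lq.
have [E|neq1] := eqVneq p1 q1.
  have p1_nil : p1 = [::].
    case: p1 E hp1 {le_n lp lq neq lp1 lq1} => // y p1 <-; by rewrite /= mem_head.
  move: lp lq neq; rewrite -E p1_nil /= => lp lq neq.
  have [||||c uc Hc] := IH x p2 q2 => //.
  - by move: le_n; rewrite p1_nil /=; lia.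
  - by apply: contraNneq neq => ->.
  by exists c => //; move: Hc => /=; lia.
exists (u :: p1 ++ x :: rev q1).
  apply/ucycle_links; split=> //.
  by apply: contra hp1 => /hasP[y yp yq]; apply/hasP; exists y; rewrite //= mem_cat; apply/orP; left.
rewrite /= !size_cat /= size_rev.
case: p1 q1 neq1 {le_n lp lq neq hp1 lp1 lq1} => [|a p1] [|b q1] //=; lia.
Qed.

End Links.

(** * Dense relations contain long paths *)

Section MinDegree.
Variables (T : finType) (r : rel T).
Hypothesis r_sym : symmetric r.

Lemma degE (S : {set T}) x : \sum_(y in S) r x y = #|[set y in S | r x y]|.
Proof.
rewrite -sum1dep_card big_mkcondr; apply: eq_bigr => y _.
by case: (r x y).
Qed.

(** Deleting a vertex of degree at most [D] lowers the degree sum by at most [2 * D], so the density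
    survives, and it excludes the empty set. *)
Lemma dense_core D (A : {set T}) :
  2 * D * #|A| < \sum_(x in A) \sum_(y in A) r x y ->
  exists S : {set T}, [/\ S \subset A, S != set0 &
    forall x, x \in S -> D < \sum_(y in S) r x y].
Proof.
have [n] := ubnP #|A|; elim: n A => // n IH A; rewrite ltnS => le_n dense.
case: (boolP [forall x in A, D < \sum_(y in A) r x y]) => [/forall_inP h|].
  exists A; split => //; apply: contraTneq dense => ->.
  by rewrite big_set0.
rewrite negb_forall_in => /exists_inP[x xA]; rewrite -leqNgt => degx.
have cA : #|A| = (#|A :\ x|).+1 by rewrite (cardsD1 x) xA.
have [||S [SA S0 hS]] := IH (A :\ x).
- by rewrite -ltnS -cA.
- move: dense; rewrite (big_setD1 x xA) /= cA.
  have -> : \sum_(y in A :\ x) \sum_(z in A) r y z =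
    \sum_(y in A :\ x) (r x y + \sum_(z in A :\ x) r y z).
    by apply: eq_bigr => y _; rewrite (big_setD1 x xA) /= r_sym.
  rewrite big_split /=.
  have : \sum_(y in A :\ x) r x y <= \sum_(y in A) r x y.
    by rewrite [X in _ <= X](big_setD1 x xA) /= leq_addl.
  lia.
by exists S; split => //; apply: subset_trans SA (subD1set _ _).
Qed.

(** Greedy extension: the last vertex has more than [D] neighbours in [S], while at most [D]
    vertices are used so far. *)
Lemma long_path D (S : {set T}) x j : x \in S -> j <= D ->
  (forall y, y \in S -> D < \sum_(z in S) r y z) ->
  exists p, [/\ size p = j, path r x p, uniq (x :: p) & {subset p <= S}].
Proof.
move=> xS + deg; elim: j => [|j IH] le_jD; first by exists [::].
have [|p [sp rp up pS]] := IH; first exact: ltnW.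
have lS : last x p \in S.
  by case: p pS {sp rp up} => [|y p] pS //=; apply: pS; exact: mem_last.
have [y /andP[yS ry] yp] : exists2 y, (y \in S) && r (last x p) y & y \notin x :: p.
  apply/exists_inP; apply: contraTT (deg _ lS).
  rewrite negb_exists_in -leqNgt => /forall_inP h.
  apply: leq_trans le_jD; rewrite degE -sp -[(size p).+1]/(size (x :: p)).
  apply: leq_trans (card_size _); apply: subset_leq_card.
  by apply/subsetP=> y; rewrite inE => /h; rewrite negbK.
exists (rcons p y); split.
- by rewrite size_rcons sp.
- by rewrite rcons_path rp.
- by rewrite -rcons_cons rcons_uniq yp.
by move=> z; rewrite mem_rcons inE => /predU1P[->|/pS].
Qed.
End MinDegree.

(** * Links of length [d.+1] in girth at least [2 * d.+1] *)

Section Girth.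
Variables (T : finType) (e : rel T) (d : nat).
Hypothesis e_sym : symmetric e.
Hypothesis girth : forall c, ucycle e c -> 3 <= size c -> 2 * d.+1 <= size c.

Lemma link_inj u v p q : link e u v p -> link e u v q ->
  size p + size q < 2 * d -> p = q.
Proof.
move=> lp lq small; apply/eqP/negPn/negP => neq.
have [c uc /andP[c3 cs]] := two_links_cycle e_sym lp lq neq.
have := girth uc c3; lia.
Qed.

(** Meeting links would yield a cycle of length at most [2 * d + 1]. *)
Lemma link_disjoint u v p q : link e u v p -> link e u v q ->
  size p = d -> size q = d -> p != q -> ~~ has (mem q) p.
Proof.
move=> lp lq sp sq neq; apply/negP => hpq.
have [c uc /andP[c3]] := two_links_cycle e_sym lp lq neq.
have := girth uc c3; rewrite hpq; lia.
Qed.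

Definition links u v : {set d.-tuple T} := [set p | link e u v (tval p)].
Definition nlinks u v := #|links u v|.

Lemma links_disjoint u v P Q x : P \in links u v -> Q \in links u v ->
  x \in P -> x \in Q -> P = Q.
Proof.
rewrite !inE => lP lQ xP xQ; apply/val_inj/eqP/negPn/negP => neq.
have /hasPn/(_ x xP)/negP[] := link_disjoint lP lQ (size_tuple P) (size_tuple Q) neq.
exact: xQ.
Qed.

Lemma mem_links_rev u v (P : d.-tuple T) : ([tuple of rev P] \in links v u) = (P \in links u v).
Proof. by rewrite !inE link_rev. Qed.

Lemma nlinks_sym u v : nlinks u v = nlinks v u.
Proof.
have le x y : nlinks x y <= nlinks y x.
  have <- : #|[set [tuple of rev P] | P : d.-tuple T in links x y]| = nlinks x y.
    by apply: card_imset => P Q [] /(can_inj revK) /val_inj.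
  by apply/subset_leq_card/subsetP => Q /imsetP[P PL ->]; rewrite mem_links_rev.
by apply/eqP; rewrite eqn_leq !le.
Qed.

Hypothesis d_gt0 : 0 < d.

(** Links with the same ends are disjoint, so each vertex of [W] blocks at most one of them. *)
Lemma fresh_link u v (W : seq T) : size W < nlinks u v ->
  exists2 P, P \in links u v & ~~ has (mem W) (tval P).
Proof.
move=> W_small; apply/exists_inP; apply: contraTT W_small.
rewrite negb_exists_in -leqNgt => /forall_inP h.
pose g (P : d.-tuple T) := nth u P (find (mem W) P).
have gP P : P \in links u v -> g P \in P /\ g P \in W.
  move=> /h; rewrite negbK => hP; split; last exact: (nth_find u hP).
  by apply: mem_nth; rewrite -has_find.
rewrite /nlinks -(card_in_imset (f := g)).
  apply: leq_trans (card_size W); apply/subset_leq_card/subsetP => x /imsetP[P PL ->].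
  by case: (gP P PL).
move=> P Q PL QL E; have [gp _] := gP P PL; have [gq _] := gP Q QL.
by apply: (links_disjoint PL QL gp); rewrite E.
Qed.

Variable k : nat.
Hypothesis k_gt : d.+1 < k.
Hypothesis noC : forall c, ucycle e c -> size c != 2 * k.

(** * First moment: links from a fixed root *)

Section FromRoot.
Variable u : T.

(* The edges between the spheres of radius d (inner) and d.+1 (outer) around u. *)
Let down x y := [exists P : d.-tuple T, link e u y (tval P) && (last u P == x)].
Let inner x := [exists P : d.-1.-tuple T, link e u x (tval P)].
Let outer y := 0 < nlinks u y.
Let r x y := down x y || down y x.

Let downP x y : down x y -> exists2 p : seq T, size p = d.-1 &
  [/\ link e u y (rcons p x), link e u x p & e x y].
Proof.
case/existsP=> -[P sP] /= /andP[lP /eqP]; move: sP.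
case/lastP: P lP => [|p z] lP; first by rewrite /= => /eqP E; move: d_gt0; rewrite -E.
rewrite last_rcons size_rcons => /eqP sP <-; exists p; first by rewrite -sP.
split=> //; move: lP; rewrite -cats1 => /link_cat[] // _.
by rewrite link_nil => /andP[].
Qed.

Let down_types x y : down x y -> inner x /\ outer y.
Proof.
move=> D; have [p sp [_ lp _]] := downP D; split.
  by apply/existsP; exists (Tuple (introT eqP sp)).
case/existsP: D => P /andP[lP _]; rewrite /outer /nlinks card_gt0; apply/set0Pn.
by exists P; rewrite inE.
Qed.

(** Two links of lengths [d] and [d.+1] with the same ends would close a cycle below the girth. *)
Let inner_outer x : inner x -> outer x -> False.
Proof.
case/existsP=> P lP; rewrite /outer /nlinks card_gt0 => /set0Pn[Q]; rewrite inE => lQ.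
have := congr1 size (link_inj lP lQ _); rewrite !size_tuple; lia.
Qed.

Let r_types x y : r x y -> (inner x && outer y) || (outer x && inner y).
Proof. by case/orP => /down_types[-> ->]; rewrite ?orbT. Qed.

Let path_types x p : path r x p -> outer x ->
  if odd (size p) then inner (last x p) else outer (last x p).
Proof.
elim/last_ind: p => [|p y IH] //; rewrite rcons_path last_rcons size_rcons /= => /andP[rp].
move=> /r_types + ox; move: (IH rp ox); case: odd => /= h /orP[] /andP[a b] //.
  by case: (inner_outer h a).
by case: (inner_outer a h).
Qed.

Let path_all_types x p : path r x p -> all (fun y => inner y || outer y) p.
Proof.
elim: p x => [|y p IH] x //= /andP[/r_types rxy /IH ->]; rewrite andbT.
by case/orP: rxy => /andP[_ ->]; rewrite ?orbT.
Qed.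

Let r_e x y : r x y -> e x y.
Proof. by case/orP => /downP[p _ []] //; rewrite e_sym. Qed.

Let down_last y P : P \in links u y -> down (last u P) y.
Proof. by rewrite inE => lP; apply/existsP; exists P; rewrite lP eqxx. Qed.

Let last_in (P : d.-tuple T) : last u P \in P.
Proof.
have : 0 < size P by rewrite size_tuple.
by rewrite memtE; case: (tval P) => //= x s _; apply: mem_last.
Qed.

(** A vertex of [t] is fewer than [d] steps from [u], too close for either sphere. This keeps paths
    of [r] off [t]. *)
Let outer_far z t y : link e u y t -> size t <= d.-1 -> z \in t ->
  inner z || outer z -> False.
Proof.
move=> lt st zt; case/splitPr: zt lt st => t1 t2 /link_cat[l1 _ _].
rewrite size_cat /= => st.
case/orP => [/existsP[P lP]|].
  have := congr1 size (link_inj lP l1 _); rewrite !size_tuple; lia.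
rewrite /outer /nlinks card_gt0 => /set0Pn[P]; rewrite inE => lP.
have := congr1 size (link_inj lP l1 _); rewrite !size_tuple; lia.
Qed.

(* A subgraph of [r] of large minimum degree contains a path of length
   2 (k - d) - 1 from an outer vertex w to an inner vertex z. Joining z to u by its
   unique path, and u to w by a fresh link, gives a cycle of length 2k. *)
Lemma sum_nlinks_le : \sum_v nlinks u v <= 4 * k * #|T|.
Proof.
rewrite leqNgt; apply/negP => big.
have r_sym : symmetric r by move=> x y; rewrite /r orbC.
have [|S [_ /set0Pn[x xS] deg]] := @dense_core T r r_sym (2 * k) setT.
  rewrite cardsT mulnA (leq_trans big) //.
  have -> : \sum_v nlinks u v = \sum_(v in [set: T]) nlinks u v.
    by apply: eq_bigl => v; rewrite inE.
  apply: leq_sum => y _; rewrite degE.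
  (* Distinct links to [y] are disjoint, so their last interior vertices are distinct neighbours of
     [y] in [r]. *)
  rewrite /nlinks -(card_in_imset (f := fun P : d.-tuple T => last u P)).
    apply/subset_leq_card/subsetP => x /imsetP[P PL ->].
    by rewrite !inE /r down_last ?orbT.
  move=> P Q PL QL E; apply: (links_disjoint PL QL (last_in P)); rewrite E; exact: last_in.
have [w wS ow] : exists2 w, w \in S & outer w.
  have := deg _ xS; rewrite degE => /(leq_ltn_trans (leq0n _)).
  rewrite card_gt0 => /set0Pn[y]; rewrite inE => /andP[yS /r_types].
  by case/orP => /andP[]; [exists y | exists x].
have [|p [sp rp up pS]] := long_path (j := 2 * (k - d) - 1) wS _ deg; first lia.
have p_odd : odd (size p) by rewrite sp; lia.
have := path_types rp ow; rewrite p_odd.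
case/lastP: p sp rp up pS {p_odd} => [|p z]; first by rewrite /=; lia.
rewrite last_rcons size_rcons => sp rp up pS /existsP[t lt].
(* As [w] is outer, each of its neighbours in [S] is the last interior vertex of a link from [u] to
   [w]. *)
have wbig : 2 * k < nlinks u w.
  apply: leq_trans (deg _ wS) _; rewrite degE.
  apply: leq_trans (leq_imset_card (fun P : d.-tuple T => last u P) _).
  apply/subset_leq_card/subsetP => y; rewrite inE => /andP[yS /orP[D|]].
    by case: (down_types D) => /inner_outer/(_ ow).
  case/existsP=> P /andP[lP /eqP <-]; apply/imsetP; exists P => //.
  by rewrite inE.
have [|P PL Pfresh] := @fresh_link u w (rcons p z ++ tval t).
  by rewrite size_cat size_rcons size_tuple; lia.
have lP : link e u w (tval P) by move: PL; rewrite inE.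
have Pfr y : y \in P -> y \notin rcons p z /\ y \notin t.
  move=> yP; have : y \notin rcons p z ++ tval t by apply: (hasPn Pfresh).
  by rewrite mem_cat negb_or => /andP.
have types y : y \in w :: rcons p z -> inner y || outer y.
  rewrite inE => /predU1P[->|]; first by rewrite ow orbT.
  by move: y; apply/allP; apply: path_all_types rp.
have u_far y : inner y || outer y -> u != y.
  case/orP => [/existsP[Q /link_neq]|] //; rewrite /outer /nlinks card_gt0.
  by case/set0Pn=> Q; rewrite inE => /link_neq.
have lA : link e u z (tval P ++ w :: p).
  rewrite /link rcons_cat /= cat_path /= mem_cat cat_uniq.
  have := link_path lP; rewrite rcons_path => /andP[-> ->] /=.
  rewrite (sub_path r_e rp) /= negb_or (link_notin_l lP) (link_uniq lP) /=.
  rewrite -rcons_cons -/(rcons (w :: p) z) in up *.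
  move: (up) => /= /andP[-> ->]; rewrite !andbT; apply/andP; split.
    by apply/negP => /types/u_far; rewrite eqxx.
  apply/norP; split; first by have := link_notin_r lP.
  by apply/hasPn => y yp; apply/negP => /= yP; case: (Pfr y yP); rewrite yp.
have uc : ucycle e (u :: (tval P ++ w :: p) ++ z :: rev (tval t)).
  apply/(ucycle_links e_sym); split=> //; rewrite has_cat negb_or; apply/andP; split.
    by apply/hasPn => y /Pfr[].
  apply/hasPn => y yp; apply/negP => /= yt.
  apply: (outer_far lt _ yt); first by rewrite size_tuple.
  by apply: types; rewrite -rcons_cons mem_rcons inE yp orbT.
have := noC uc; rewrite /= !size_cat /= !size_rev !size_tuple; lia.
Qed.
End FromRoot.
End Girth.

(** * Rich and poor pairs of paths *)

Section RichPairs.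
Variables (T : finType) (e : rel T) (d : nat).
Hypothesis e_sym : symmetric e.
Hypothesis girth : forall c, ucycle e c -> 3 <= size c -> 2 * d.+1 <= size c.

Local Notation links := (links e d).
Local Notation nlinks := (nlinks e d).

(** Built from the far end: the walk from [st 1] treats [st 0] as forbidden, then a fresh link from
    [st 0] avoids [W] and that walk. [K] exceeds the number of vertices to avoid at every stage. *)
Lemma hops K (st : nat -> T) J (W : seq T) :
  (forall a, a < J -> K <= nlinks (st a) (st a.+1)) ->
  (forall a b, a <= J -> b <= J -> st a = st b -> a = b) ->
  (forall a, a <= J -> st a \notin W) ->
  size W + d.+1 * J < K ->
  exists q, [/\ path e (st 0) q, last (st 0) q = st J, size q = d.+1 * J,
    uniq (st 0 :: q) & ~~ has (mem W) (st 0 :: q)].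
Proof.
elim: J st W => [|J IH] st W rich st_inj stW; rewrite (mulnS, muln0) => K_big.
  by exists [::]; split; rewrite //= orbF; apply: stW.
have [|||| q [pq lq sq uq hq]] := IH (st \o S) (st 0 :: W).
- by move=> a aJ; apply: rich.
- by move=> a b aJ bJ /= /st_inj H; apply: succn_inj; apply: H.
- move=> a aJ; rewrite inE negb_or stW // andbT; apply/eqP => /st_inj H.
  by have := H aJ isT.
- by rewrite /=; lia.
have [|P PL Pfresh] := @fresh_link T e d e_sym girth (st 0) (st 1) (W ++ st 1 :: q).
  by apply: leq_trans (rich 0 isT); rewrite size_cat /= sq; lia.
have lP : link e (st 0) (st 1) P by move: PL; rewrite inE.
have Pfr y : y \in tval P -> y \notin W /\ y \notin st 1 :: q.
  move=> yP; have : y \notin W ++ st 1 :: q by apply: (hasPn Pfresh).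
  by rewrite mem_cat negb_or => /andP.
exists (tval P ++ st 1 :: q); split.
- have := link_path lP; rewrite rcons_path cat_path => /andP[-> /= ->]; exact: pq.
- by rewrite last_cat.
- by rewrite size_cat /= sq size_tuple; lia.
- rewrite cons_uniq mem_cat cat_uniq negb_or (link_notin_l lP) (link_uniq lP) uq andbT.
  apply/andP; split.
    apply/negP => h0; case/hasP: hq; exists (st 0) => //; exact: mem_head.
  apply/hasPn => y yq; apply/negP => /= yP; case: (Pfr y yP) => _.
  by rewrite yq.
apply/hasPn => y; rewrite inE => /predU1P[->|]; first exact: stW.
rewrite mem_cat => /orP[/Pfr[]//|yq].
apply/negP => /= yW; case/hasP: hq; exists y => //.
by rewrite /= inE; apply/orP; right.
Qed.

(* With vertices of the [d.+1]-step path [u P v] numbered from 0, [tnth P i] is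
   number [i.+1] of P and [tnth Q (rev_ord i)] is number [d.+1 - i.+1] of Q, so
   the two are antipodal on the cycle formed by P and Q. *)
Definition cross (i : 'I_d) (P Q : d.-tuple T) := nlinks (tnth P i) (tnth Q (rev_ord i)).

Definition rich_pair K i (P Q : d.-tuple T) :=
  [&& P != Q, K <= cross i P Q & K <= cross i Q P].

Lemma rich_pair_sym K i : symmetric (rich_pair K i).
Proof. by move=> P Q; rewrite /rich_pair eq_sym; congr (_ && _); apply: andbC. Qed.

Lemma tuple_split (P : d.-tuple T) (i : 'I_d) :
  tval P = take i P ++ tnth P i :: drop i.+1 P.
Proof.
by rewrite (tnth_nth (tnth P i)) -drop_nth ?size_tuple // cat_take_drop.
Qed.

(* Leave u along the first path up to its i-th interior vertex, hop through fresh
   links to the antipodal vertices of the successive paths, and return to u along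
   the last path. *)
Lemma rich_chain_cycle K (i : 'I_d) u v P ps :
  0 < size ps -> d.+1 * (size ps).+2 < K ->
  uniq (P :: ps) -> {subset P :: ps <= links u v} ->
  path (rich_pair K i) P ps ->
  exists2 c, ucycle e c & size c =
    2 + i + d.+1 * size ps + (if odd (size ps) then d - i.+1 else i).
Proof.
move=> J_gt0 K_big ups psL rps.
(* The stations alternate between index [i] and its antipode, since each hop lands on the antipodal
   vertex of the next path. *)
pose J := size ps; rewrite -/J in J_gt0; pose idx b := if b then rev_ord i else i.
pose Pn a := nth P (P :: ps) a; pose st a := tnth (Pn a) (idx (odd a)).
have PnL a : a <= J -> Pn a \in links u v.
  by move=> aJ; apply: psL; apply: mem_nth.
have Pn_link a : a <= J -> link e u v (tval (Pn a)).
  by move/PnL; rewrite inE.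
(* By disjointness of links, an interior vertex determines the path containing it. *)
have Pn_eq a b x : a <= J -> b <= J -> x \in Pn a -> x \in Pn b -> a = b.
  move=> aJ bJ xa xb; have /eqP := links_disjoint e_sym girth (PnL a aJ) (PnL b bJ) xa xb.
  by rewrite (nth_uniq P) // => /eqP.
have st_in a : st a \in Pn a by apply: mem_tnth.
pose Q := Pn J; pose i' := idx (odd J).
have l0 : link e u (st 0) (take i P).
  have H := Pn_link 0 isT; rewrite /Pn /= (tuple_split P i) in H.
  by case/link_cat: H.
have lJ : link e u (st J) (take i' Q).
  have H := Pn_link J (leqnn J); rewrite -/Q (tuple_split Q i') in H.
  by case/link_cat: H.
pose W := u :: take i P ++ take i' Q.
have [||||q [pq lq sq uq hq]] := @hops K st J W.
- move=> a aJ; have /(pathP P)/(_ a aJ)/and3P[_ h1 h2] := rps.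
  move: h1 h2; rewrite /st /cross /Pn -/(Pn a) -/(Pn a.+1) /=.
  by rewrite /idx; case: (odd a) => //= _; rewrite nlinks_sym.
- move=> a b aJ bJ E; by apply: (Pn_eq a b _ aJ bJ (st_in a)); rewrite E; apply: st_in.
- move=> a aJ; rewrite inE mem_cat !negb_or; apply/and3P; split.
  + by apply: contraNneq (link_notin_l (Pn_link a aJ)) => <-.
  + apply/negP => h; have a0 : a = 0 by apply: (Pn_eq a 0 _ aJ isT (st_in a) (mem_take h)).
    by move: h; rewrite a0 (negbTE (link_notin_r l0)).
  + apply/negP => h; have a0 : a = J by apply: (Pn_eq a J _ aJ (leqnn J) (st_in a) (mem_take h)).
    by move: h; rewrite a0 (negbTE (link_notin_r lJ)).
- rewrite /= size_cat !size_take !size_tuple !ltn_ord.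
  move: (ltn_ord i) (ltn_ord i') K_big; rewrite -/J !mulnS; lia.
have sizes : i' = (if odd J then d - i.+1 else i) :> nat by rewrite /i' /idx; case: odd.
exists (u :: take i P ++ st 0 :: q ++ rev (take i' Q)).
  apply/andP; split.
    rewrite /= !rcons_cat /= !rcons_cat cat_path /= cat_path lq pq /=.
    have := link_path l0; rewrite rcons_path => /andP[-> ->] /=.
    by move: lJ; rewrite -link_rev // => /link_path.
  have U0 : uniq (u :: take i P) by rewrite /= (link_notin_l l0) (link_uniq l0).
  rewrite -cat_cons cat_uniq -cat_cons cat_uniq has_cat rev_uniq uq U0.
  rewrite (link_uniq lJ) !andbT !andTb negb_or -andbA.
  have qW y : y \in st 0 :: q -> y \notin W by move=> yq; apply: (hasPn hq).
  apply/and3P; split.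
  - by apply/hasPn => y /qW; rewrite /W -cat_cons mem_cat negb_or => /andP[] /= ->.
  - rewrite has_rev; apply/hasPn => y yQ; apply/negP => /=.
    rewrite inE => /predU1P[E|yP].
      by move: (link_notin_l lJ); rewrite -E yQ.
    (* As [0 < J], the first and the last path differ and share no interior vertex. *)
    have := Pn_eq 0 J y isT (leqnn J) (mem_take yP) (mem_take yQ); lia.
  rewrite has_rev; apply/hasPn => y yQ; apply/negP => /= /qW.
  by rewrite /W inE mem_cat yQ !orbT.
rewrite /= size_cat /= size_cat size_rev sq !size_take !size_tuple !ltn_ord -sizes -/J; lia.
Qed.
End RichPairs.

(** * Counting poor pairs by re-splitting cycles *)

Section PoorPairs.
Variables (T : finType) (e : rel T) (d : nat).
Hypothesis e_sym : symmetric e.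
Hypothesis girth : forall c, ucycle e c -> 3 <= size c -> 2 * d.+1 <= size c.

Local Notation links := (links e d).
Local Notation nlinks := (nlinks e d).
Local Notation quad := ((T * T) * (d.-tuple T * d.-tuple T))%type.

Lemma card_sum_fibres (A B : finType) (r : A -> B -> bool) :
  #|[set z : A * B | r z.1 z.2]| = \sum_a \sum_b r a b.
Proof.
rewrite -sum1dep_card big_mkcond pair_bigA; apply: eq_bigr => z _.
by case: (r _ _).
Qed.

Definition quad_cycle (z : quad) : seq T :=
  z.1.1 :: tval z.2.1 ++ z.1.2 :: rev (tval z.2.2).

Lemma quad_cycle_inj : injective quad_cycle.
Proof.
move=> [[u v] [P Q]] [[u' v'] [P' Q']] /= [-> /eqP].
rewrite eqseq_cat ?size_tuple // => /andP[/eqP/val_inj-> /eqP[-> /(can_inj revK)/val_inj->]].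
by [].
Qed.

Definition linked (z : quad) :=
  [&& z.2.1 \in links z.1.1 z.1.2, z.2.2 \in links z.1.1 z.1.2 & z.2.1 != z.2.2].

Lemma linked_cycle z : linked z -> ucycle e (quad_cycle z).
Proof.
case: z => [[u v] [P Q]]; rewrite /linked /= !inE => /and3P[lP lQ neq].
apply/(ucycle_links e_sym); split=> //.
exact: (link_disjoint e_sym girth lP lQ (size_tuple P) (size_tuple Q) neq).
Qed.

Lemma cycle_linked z : ucycle e (quad_cycle z) ->
  z.2.1 \in links z.1.1 z.1.2 /\ z.2.2 \in links z.1.1 z.1.2.
Proof.
by case: z => [[u v] [P Q]] /(ucycle_links e_sym)[lP lQ _]; rewrite !inE.
Qed.

(* Splits the 2 * d.+1-cycle formed by P and Q at another antipodal pair. *)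
Definition quad_rot (i : 'I_d) (z : quad) : quad :=
  let: ((u, v), (P, Q)) := z in
  ((tnth P i, tnth Q (rev_ord i)),
   (insubd P (drop i.+1 P ++ v :: rev (drop (rev_ord i).+1 Q)),
    insubd Q (rev (take i P) ++ u :: take (rev_ord i) Q))).

(** Re-splitting only moves the starting point of the cyclic sequence; hence [quad_rot] is injective
    and preserves cycles. *)
Lemma quad_rotE i z : quad_cycle (quad_rot i z) = rot i.+1 (quad_cycle z).
Proof.
case: z => [[u v] [P Q]]; rewrite /quad_cycle /=.
have i_lt := ltn_ord i; have j_lt := ltn_ord (rev_ord i).
rewrite !val_insubd !size_cat /= !size_rev !size_drop !size_take !size_tuple i_lt j_lt /=.
(* Both new interiors have exactly [d] vertices, so the defaults of [insubd] never occur. *)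
rewrite !ifT; try by apply/eqP => /=; lia.
set j := rev_ord i in j_lt *; rewrite rev_cat revK rev_cons.
have EP := tuple_split P i; have EQ := tuple_split Q j.
transitivity (rot i.+1 ((u :: take i P) ++ tnth P i :: drop i.+1 P ++ v ::
  rev (drop j.+1 Q) ++ tnth Q j :: rev (take j Q))).
  have R s : rot i.+1 ((u :: take i P) ++ s) = s ++ u :: take i P.
    by rewrite (_ : i.+1 = size (u :: take i P)) ?rot_size_cat //= size_take size_tuple i_lt.
  by rewrite R -[d - i.+1]/(nat_of_ord j) /= -?catA /= ?cat_rcons -?catA /= -?catA.
have EP' s : tval P ++ s = take i P ++ tnth P i :: drop i.+1 P ++ s.
  by rewrite {1}EP -catA.
have EQ' : rev (tval Q) = rev (drop j.+1 Q) ++ tnth Q j :: rev (take j Q).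
  by rewrite {1}EQ rev_cat rev_cons cat_rcons.
by rewrite EP' EQ'.
Qed.

(** After re-splitting, the new ends have fewer than [K] links, so each of the [#|T| ^ 2] pairs of
    ends carries at most [K ^ 2] pairs of links. *)
Lemma card_poor_quads K i :
  #|[set z : quad | linked z && (cross e i z.2.1 z.2.2 < K)]| <= K ^ 2 * #|T| ^ 2.
Proof.
pose poor (xy : T * T) := nlinks xy.1 xy.2 < K.
pose B := [set z : quad | poor z.1 &&
  ((z.2.1 \in links z.1.1 z.1.2) && (z.2.2 \in links z.1.1 z.1.2))].
apply: (@leq_trans #|B|).
  rewrite -(card_imset _ (f := quad_rot i)); last first.
    move=> z z' /(congr1 quad_cycle); rewrite !quad_rotE => /rot_inj.
    exact: quad_cycle_inj.
  apply/subset_leq_card/subsetP => y /imsetP[z]; rewrite inE => /andP[lz zK ->].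
  rewrite inE; apply/andP; split; first by case: z zK {lz} => [[? ?] [? ?]].
  apply/andP/cycle_linked; rewrite quad_rotE; move/linked_cycle: lz.
  by rewrite /ucycle rot_cycle rot_uniq.
rewrite /B (card_sum_fibres (fun xy PQ =>
  poor xy && ((PQ.1 \in links xy.1 xy.2) && (PQ.2 \in links xy.1 xy.2)))).
apply: (@leq_trans (\sum_(xy : T * T) K ^ 2)); last first.
  by rewrite sum_nat_const card_prod !expnS !expn0 !muln1 mulnC.
apply: leq_sum => xy _; rewrite /poor; case: ltnP => [xyK|_] /=; last by rewrite big1.
rewrite -(pair_bigA _ (fun P Q =>
  nat_of_bool ((P \in links xy.1 xy.2) && (Q \in links xy.1 xy.2)))) /=.
apply: (@leq_trans (nlinks xy.1 xy.2 * nlinks xy.1 xy.2)); last first.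
  by rewrite expnS expn1 leq_mul // ltnW.
rewrite /nlinks -!sum1_card big_distrlr /= [X in _ <= X]big_mkcond /=.
apply: leq_sum => P _; case: (P \in _) => /=; last by rewrite big1.
rewrite [X in _ <= X]big_mkcond /=; apply: leq_sum => Q _.
by case: (Q \in _).
Qed.
End PoorPairs.

(* The length produced by [rich_chain_cycle] is made equal to 2k: writing
   k = q * d.+1 + t, take i.+1 = t and J = 2q if t > 0, else i.+1 = 1 and J = 2q - 1. *)
Lemma closing_index d k : 0 < d -> d.+1 < k -> exists (i : 'I_d) (J : nat),
  [/\ 0 < J, J <= 2 * k &
    2 + i + d.+1 * J + (if odd J then d - i.+1 else i) = 2 * k].
Proof.
move=> d_gt0 k_gt; have E := divn_eq k d.+1; have t_lt := ltn_pmod k (ltn0Sn d).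
have q_gt0 : 0 < k %/ d.+1 by rewrite divn_gt0 // ltnW.
have q_le : k %/ d.+1 <= k by apply: leq_div.
move: q_gt0 q_le E t_lt; set q := k %/ _; set t := k %% _; case: t => [|i] q_gt0 q_le E t_lt.
  exists (Ordinal d_gt0), (2 * q).-1; split=> /=; [lia|lia|].
  have -> : odd (2 * q).-1 by lia.
  by case: q E q_gt0 q_le => // q ->; lia.
have i_lt : i < d by lia.
exists (Ordinal i_lt), (2 * q); split=> /=; [lia|lia|].
have -> : odd (2 * q) = false by lia.
by rewrite E mulnDr mulnCA [_ * q]mulnC mulnCA; lia.
Qed.

(** The first summand covers equal and rich pairs, through the first moment and [J <= 2 * k]; the
    second covers poor pairs in both orders. *)
Definition sum_sqr_const d k := 4 * k * (1 + 4 * k) + 2 * (d.+1 * (2 * k).+2).+1 ^ 2.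

(** * The second moment of the number of links *)

Section SumSquares.
Variables (T : finType) (e : rel T) (d k : nat).
Hypothesis e_sym : symmetric e.
Hypothesis girth : forall c, ucycle e c -> 3 <= size c -> 2 * d.+1 <= size c.
Hypothesis d_gt0 : 0 < d.
Hypothesis k_gt : d.+1 < k.
Hypothesis noC : forall c, ucycle e c -> size c != 2 * k.

Local Notation links := (links e d).
Local Notation nlinks := (nlinks e d).

(** A denser relation would contain a chain of [J] rich steps, which closes to a cycle of length
    [2 * k]. *)
Lemma rich_pairs_le K (i : 'I_d) J u v : 0 < J -> d.+1 * J.+2 < K ->
  2 + i + d.+1 * J + (if odd J then d - i.+1 else i) = 2 * k ->
  \sum_(P in links u v) \sum_(Q in links u v) rich_pair e K i P Q <= 2 * J * nlinks u v.
Proof.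
move=> J_gt0 K_big E; rewrite leqNgt; apply/negP => dense.
have [S [SL /set0Pn[P PS] deg]] := dense_core (@rich_pair_sym T e d K i) dense.
have [ps [sps rps ups psS]] := long_path PS (leqnn J) deg.
have [||||| c uc sc] := @rich_chain_cycle T e d e_sym girth K i u v P ps; rewrite ?sps //.
  by move=> Q; rewrite inE => /predU1P[->|/psS]; apply: (subsetP SL).
by have := noC uc; rewrite sc sps E eqxx.
Qed.

Lemma sum_sqr_nlinks_le :
  \sum_u \sum_v nlinks u v ^ 2 <= sum_sqr_const d k * #|T| ^ 2.
Proof.
have [i [J [J_gt0 J_le E]]] := closing_index d_gt0 k_gt.
pose K := (d.+1 * (2 * k).+2).+1.
have K_big : d.+1 * J.+2 < K by rewrite ltnS leq_mul2l !ltnS J_le orbT.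
pose poor u v P Q : nat := linked e ((u, v), (P, Q)) && (cross e i P Q < K).
(* Two paths are equal, form a rich pair, or are poor in at least one order. *)
have sumsq u v : nlinks u v ^ 2 <= nlinks u v + 2 * J * nlinks u v +
   \sum_P \sum_Q (poor u v P Q + poor u v Q P).
  apply: (@leq_trans (\sum_(P in links u v) \sum_(Q in links u v)
     ((P == Q) + rich_pair e K i P Q + (poor u v P Q + poor u v Q P)))).
    rewrite expnS expn1 {1 2}/nlinks -!sum1_card big_distrlr /=.
    apply: leq_sum => P PL; apply: leq_sum => Q QL.
    rewrite muln1 /poor /linked /rich_pair /= PL QL /= [Q == P]eq_sym.
    by case: eqVneq => //= _; case: (ltnP (cross e i P Q) K) => //=; case: (ltnP (cross e i Q P) K).
  under eq_bigr => P _ do rewrite !big_split /=.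
  rewrite !big_split /= -!addnA; apply: leq_add; last apply: leq_add.
  - rewrite /nlinks -[X in _ <= X]sum1_card; apply: leq_sum => P PL.
    by rewrite (bigD1 P PL) /= eqxx big1 // => Q /andP[_ /negbTE]; rewrite eq_sym => ->.
  - exact: rich_pairs_le.
  have sub (F : d.-tuple T -> nat) : \sum_(P in links u v) F P <= \sum_P F P.
    by rewrite big_mkcond; apply: leq_sum => P _; case: ifP.
  rewrite -!big_split /=; apply: leq_trans (sub _) _; apply: leq_sum => P _.
  by rewrite -!big_split /=; apply: sub.
have sum_poor : \sum_u \sum_v \sum_P \sum_Q poor u v P Q <= K ^ 2 * #|T| ^ 2.
  apply: leq_trans (card_poor_quads e_sym girth K i).
  rewrite (card_sum_fibres (fun uv PQ => linked e (uv, PQ) && (cross e i PQ.1 PQ.2 < K))).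
  rewrite pair_bigA /=; apply: leq_sum => -[u v] _ /=.
  by rewrite pair_bigA; apply: leq_sum => -[P Q] _.
apply: (@leq_trans (\sum_u \sum_v ((1 + 2 * J) * nlinks u v +
   (\sum_P \sum_Q poor u v P Q + \sum_P \sum_Q poor u v P Q)))).
  apply: leq_sum => u _; apply: leq_sum => v _; apply: leq_trans (sumsq u v) _.
  rewrite mulnDl mul1n leq_add2l.
  under eq_bigr do rewrite big_split /=.
  rewrite big_split /= leq_add2l exchange_big /=.
  exact: leqnn.
under eq_bigr do rewrite !big_split /= -big_distrr /=.
rewrite !big_split /= -big_distrr /=.
have : \sum_u \sum_v nlinks u v <= 4 * k * #|T| ^ 2.
  apply: (@leq_trans (\sum_(u : T) 4 * k * #|T|)).
    by apply: leq_sum => u _; apply: sum_nlinks_le.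
  by rewrite sum_nat_const expnS expn1 mulnC mulnA.
rewrite /sum_sqr_const -/K mulnDl.
move: sum_poor; set s1 := \sum_u _; set s2 := \sum_u _; set n2 := #|T| ^ 2 => h1 h2.
apply: leq_add.
  have J_le' : 1 + 2 * J <= 1 + 4 * k by lia.
  by have := leq_mul J_le' h2; rewrite mulnA [(1 + 4 * k) * _]mulnC.
by rewrite addnn -mul2n -mulnA leq_mul2l.
Qed.
End SumSquares.

(** * Counting long cycles *)

(** Sum the bound of twice a product by the two squares, applied to [a i * b j] and [a j * b i],
    over all [i] and [j]. *)
Lemma sum_cauchy (I : finType) (a b : I -> nat) :
  (\sum_i a i * b i) ^ 2 <= (\sum_i a i ^ 2) * (\sum_i b i ^ 2).
Proof.
have E : (\sum_i a i ^ 2) * (\sum_i b i ^ 2) = \sum_i \sum_j a i ^ 2 * b j ^ 2.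
  by rewrite big_distrlr.
have E' : (\sum_i a i ^ 2) * (\sum_i b i ^ 2) = \sum_i \sum_j a j ^ 2 * b i ^ 2.
  by rewrite E exchange_big.
have -> : (\sum_i a i * b i) ^ 2 = \sum_i \sum_j (a i * b i) * (a j * b j).
  by rewrite -mulnn big_distrlr.
rewrite -(leq_pmul2l (isT : 0 < 2)) [leqRHS]mul2n -addnn {1}E E' big_distrr -big_split /=.
apply: leq_sum => i _; rewrite big_distrr -big_split /=; apply: leq_sum => j _.
have := nat_Cauchy (a i * b j) (a j * b i); rewrite !expnMn.
have -> : a i * b i * (a j * b j) = a i * b j * (a j * b i) by lia.
by case.
Qed.

(** * Matrix powers and their trace *)

Section Trace.
Variables (T : finType) (f : T -> T -> nat).

Fixpoint power m u v : nat := if m is m'.+1 then \sum_w f u w * power m' w v else (u == v).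

(** The squared Frobenius norm. *)
Let norm (g : T -> T -> nat) := \sum_u \sum_v g u v ^ 2.

(** Submultiplicativity: Cauchy-Schwarz is applied to each entry of the product. *)
Lemma norm_power m : norm (power m.+1) <= norm f ^ m.+1.
Proof.
elim: m => [|m IH].
  rewrite expn1; apply: leq_sum => u _; apply: leq_sum => v _ /=.
  rewrite (bigD1 v) //= eqxx muln1 big1 ?addn0 // => w /negbTE ->.
  by rewrite muln0.
rewrite expnS; apply: leq_trans (leq_mul (leqnn _) IH).
rewrite [X in _ <= X * _]/norm big_distrl /=; apply: leq_sum => u _.
rewrite /norm exchange_big /= big_distrr /=; apply: leq_sum => v _.
exact: sum_cauchy.
Qed.

(** The trace is the inner product of [f] with the transpose of the remaining power. *)
Lemma trace_power m : (\sum_u power m.+2 u u) ^ 2 <= norm f ^ m.+2.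
Proof.
rewrite expnS; apply: leq_trans (leq_mul (leqnn _) (norm_power m)).
have -> : \sum_u power m.+2 u u = \sum_p f p.1 p.2 * power m.+1 p.2 p.1.
  exact: (pair_bigA _ (fun u w => f u w * power m.+1 w u)).
have -> : norm f = \sum_p f p.1 p.2 ^ 2 by apply: (pair_bigA _ (fun u w => f u w ^ 2)).
have -> : norm (power m.+1) = \sum_p power m.+1 p.2 p.1 ^ 2.
  by rewrite /norm exchange_big; apply: (pair_bigA _ (fun u w => power m.+1 w u ^ 2)).
exact: sum_cauchy.
Qed.
End Trace.

(** * Cycles as closed chains of links *)

Section CountCycles.
Variables (T : finType) (e : rel T) (d : nat).

(** Here [p] lists every vertex after [u], ends of links included, in blocks of [d.+1]. Different
    blocks may meet, so a matrix power bounds the count. *)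
Fixpoint chain m u (p : seq T) v := if m is m'.+1 then
  link e u (nth u p d) (take d p) && chain m' (nth u p d) (drop d.+1 p) v
  else u == v.

Lemma card_chain m u v :
  #|[set p : (m * d.+1).-tuple T | chain m u p v]| <= power (nlinks e d) m u v.
Proof.
elim: m u => [|m IH] u /=.
  case: eqP => _; last by rewrite (_ : [set p | _] = set0) ?cards0 //; apply/setP => p; rewrite !inE.
  by apply: leq_trans (max_card _) _; rewrite card_tuple expn0.
pose D := [set z : T * (d.-tuple T * (m * d.+1).-tuple T) |
  (z.2.1 \in links e d u z.1) && chain m z.1 z.2.2 v].
pose g (p : (m.+1 * d.+1).-tuple T) : T * (d.-tuple T * (m * d.+1).-tuple T) :=
  (nth u p d, (insubd (nseq_tuple d u) (take d p),
    insubd (nseq_tuple (m * d.+1) u) (drop d.+1 p))).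
have g1 p : val (g p).2.1 = take d p.
  by rewrite val_insubd size_take size_tuple ifT //; case: ltnP => //; lia.
have g2 p : val (g p).2.2 = drop d.+1 p.
  by rewrite val_insubd size_drop size_tuple ifT //; apply/eqP; lia.
apply: (@leq_trans #|D|).
  rewrite -(card_imset _ (f := g)).
    apply/subset_leq_card/subsetP => z /imsetP[p]; rewrite inE /= => /andP[lp cp] ->.
    by rewrite inE (g2 p) inE (g1 p) lp.
  move=> p q E; apply: val_inj => /=.
  have Ey : nth u p d = nth u q d by case: E.
  have Et : take d p = take d q by rewrite -!g1 E.
  rewrite -(cat_take_drop d.+1 p) -(cat_take_drop d.+1 q) -!g2 E.
  by rewrite !(take_nth u) ?size_tuple ?Ey ?Et // mulSn leq_addr.
rewrite /D (card_sum_fibres (fun w (Pq : d.-tuple T * (m * d.+1).-tuple T) =>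
  (Pq.1 \in links e d u w) && chain m w Pq.2 v)).
apply: leq_sum => w _; apply: leq_trans (leq_mul (leqnn _) (IH w)).
rewrite -sum1dep_card /nlinks -sum1_card big_distrlr /=.
rewrite -(pair_bigA _ (fun P (q : (m * d.+1).-tuple T) =>
  nat_of_bool ((P \in links e d u w) && chain m w q v))) /=.
rewrite [X in _ <= X]big_mkcond /=; apply: leq_sum => P _.
case: (P \in _) => /=; last by rewrite big1.
by rewrite [X in _ <= X]big_mkcond; apply: leq_sum => q _; case: chain.
Qed.

(** As [p] has no repetition, only the first block must be required to avoid [u]; a closed chain
    returns to [u] later. *)
Lemma path_chain m u p v : path e u p -> uniq p -> last u p = v ->
  size p = m * d.+1 -> (0 < m -> u \notin take d.+1 p) -> chain m u p v.
Proof.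
elim: m u p => [|m IH] u p /=.
  by move=> _ _ <- /size0nil ->; rewrite /= eqxx.
move=> pp up lp sp /(_ isT) nu.
have d_lt : d < size p by rewrite sp mulSn; lia.
set y := nth u p d.
have E : p = rcons (take d p) y ++ drop d.+1 p by rewrite -take_nth // cat_take_drop.
have Et : take d.+1 p = rcons (take d p) y by rewrite -take_nth.
move: pp up lp; rewrite {1 2 3}E cat_path cat_uniq last_cat last_rcons.
case/andP=> p1 p2 /and3P[u1 nh u2] lp; apply/andP; split.
  by rewrite /link p1 /= -Et nu Et.
apply: IH => //; first by rewrite size_drop sp; lia.
move=> _; apply: contra nh => /mem_take yd; apply/hasP; exists y => //=.
by rewrite mem_rcons mem_head.
Qed.

(** Rotation by one moves the first vertex [u] to the end, turning the cycle into a closed chain at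
    [u]. *)
Lemma card_ucycles m : 1 < m ->
  #|[set c : (m * d.+1).-tuple T | cycle e c && uniq c]| <= \sum_u power (nlinks e d) m u u.
Proof.
move=> m_gt1; pose C := [set p : (m * d.+1).-tuple T | [exists u, chain m u p u]].
apply: (@leq_trans #|C|).
  rewrite -(card_imset _ (f := fun c : (m * d.+1).-tuple T => [tuple of rot 1 c])); last first.
    by move=> c c' /(congr1 val) /= /rot_inj /val_inj.
  apply/subset_leq_card/subsetP => p /imsetP[c]; rewrite inE => uc ->; rewrite inE /=.
  have := size_tuple c; case: (tval c) uc => [|u p'] /= uc sp; first by lia.
  apply/existsP; exists u; rewrite rot1_cons; move/andP: uc => [pp /andP[up' Up']].
  apply: path_chain => //.
  - by rewrite rcons_uniq up'.
  - by rewrite last_rcons.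
  - by rewrite size_rcons.
  (* With at least two blocks, the first one ends before the return to [u]. *)
  move=> _; rewrite -cats1 takel_cat; first by apply: contra up' => /mem_take.
  have : 2 * d.+1 <= m * d.+1 by rewrite leq_pmul2r.
  by rewrite -sp; lia.
apply: (@leq_trans (\sum_u #|[set p : (m * d.+1).-tuple T | chain m u p u]|)); last first.
  by apply: leq_sum => u _; apply: card_chain.
rewrite -sum1dep_card [X in X <= _]big_mkcond.
under [X in _ <= X]eq_bigr do rewrite -sum1dep_card big_mkcond.
rewrite exchange_big; apply: leq_sum => p _.
case: existsP => // -[u cu]; rewrite (bigD1 u) //= cu; lia.
Qed.
End CountCycles.

(** * Cycle copies as cyclic sequences *)

Section Translation.
Variables (n : nat) (E : {set {set 'I_n}}).

Definition adj (x y : 'I_n) := [set x; y] \in E.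

Lemma adj_sym : symmetric adj.
Proof. by move=> x y; rewrite /adj setUC. Qed.

Lemma cycle_nthP (T : eqType) (e : rel T) x0 (c : seq T) :
  reflect (forall i, i < size c -> e (nth x0 c i) (nth x0 c (i.+1 %% size c))) (cycle e c).
Proof.
case: c => [|x s]; first by apply: ReflectT.
have E1 i : i < (size s).+1 -> nth x0 (x :: rcons s x) i = nth x0 (x :: s) i.
  by move=> i_lt; rewrite -rcons_cons nth_rcons /= i_lt.
have E2 i : i < (size s).+1 -> nth x0 (rcons s x) i = nth x0 (x :: s) (i.+1 %% (size s).+1).
  rewrite ltnS leq_eqVlt nth_rcons => /predU1P[->|i_lt]; first by rewrite ltnn eqxx modnn.
  by rewrite i_lt modn_small.
apply: (iffP (pathP x0)) => /= h i; rewrite ?size_rcons => i_lt.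
  by rewrite -E1 // -E2 //; apply: h; rewrite size_rcons.
by rewrite E1 // E2 //; apply: h.
Qed.

Lemma cycle_tupleP (T : eqType) (e : rel T) j (c : j.-tuple T) :
  reflect (forall i, e (tnth c i) (tnth c (ordS i))) (cycle e c).
Proof.
case: j c => [|j] c; first by rewrite tuple0; apply: ReflectT => -[].
have [x0 _] : {x0 : T | True} by exists (tnth c ord0).
apply: (iffP (cycle_nthP e x0 c)); rewrite size_tuple => h i.
  by rewrite !(tnth_nth x0); apply: h.
by move=> i_lt; have := h (Ordinal i_lt); rewrite !(tnth_nth x0).
Qed.

Lemma cyc_edges_sub j (c : j.-tuple 'I_n) :
  (cyc_edges (finfun (tnth c)) \subset E) = cycle adj c.
Proof.
apply/subsetP/cycle_tupleP => [sub i|h s /imsetP[i _ ->]].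
  by apply: sub; apply/imsetP; exists i; rewrite ?ffunE.
by rewrite !ffunE; apply: h.
Qed.

Lemma injective_tnth j (T : finType) (c : j.-tuple T) :
  injectiveb (finfun (tnth c)) = uniq c.
Proof.
rewrite /injectiveb /dinjectiveb; congr uniq.
rewrite -[RHS]map_tnth_enum; apply: eq_map => i; exact: ffunE.
Qed.

Lemma has_cycle_ucycle j : has_cycle j E <-> exists c : j.-tuple 'I_n, ucycle adj c.
Proof.
have ucE (c : j.-tuple 'I_n) :
  injectiveb (finfun (tnth c)) && (cyc_edges (finfun (tnth c)) \subset E) -> ucycle adj c.
  by rewrite injective_tnth cyc_edges_sub andbC.
split=> [/existsP[f]|[c uc]].
  have -> : f = finfun (tnth [tuple f i | i < j]).
    by apply/ffunP => i; rewrite ffunE tnth_mktuple.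
  by move/ucE => uc; eexists; exact: uc.
apply/existsP; exists (finfun (tnth c)).
by rewrite injective_tnth cyc_edges_sub andbC.
Qed.

Lemma cycle_free_ucycle (F : pred nat) (c : seq 'I_n) :
  cycle_free F E -> ucycle adj c -> ~~ F (size c).
Proof.
move=> free uc; apply: contra free => Fc.
(* [cycle_free] only ranges over lengths up to [n]. *)
have c_lt : size c < n.+1.
  by case/andP: uc => _ /card_uniqP <-; rewrite ltnS -[X in _ <= X]card_ord max_card.
apply/existsP; exists (Ordinal c_lt); rewrite Fc; apply/has_cycle_ucycle.
by exists (in_tuple c).
Qed.

Lemma count_cycles_le j :
  count_cycles j E <= #|[set c : j.-tuple 'I_n | cycle adj c && uniq c]|.
Proof.
apply: leq_trans (leq_imset_card (fun c : j.-tuple 'I_n => cyc_edges (finfun (tnth c))) _).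
apply/subset_leq_card/subsetP => S; rewrite inE powersetE.
move=> /andP[SE /existsP[f /andP[f_inj /eqP defS]]].
have Ef : f = finfun (tnth [tuple f i | i < j]).
  by apply/ffunP => i; rewrite ffunE tnth_mktuple.
apply/imsetP; exists [tuple f i | i < j]; last by rewrite -Ef.
by rewrite inE -cyc_edges_sub -injective_tnth -Ef f_inj -defS SE.
Qed.
End Translation.

Lemma count_cycles_fam_le n (E : {set {set 'I_n}}) l k m :
  1 < l -> l < k -> 1 < m -> cycle_free (fam l k) E ->
  count_cycles (m * l) E <= sum_sqr_const l.-1 k ^ m * n ^ m.
Proof.
case: l => // d; rewrite ltnS => d_gt0 k_gt m_gt1 free /=.
have girth c : ucycle (adj E) c -> 3 <= size c -> 2 * d.+1 <= size c.
  move=> uc c3; have := cycle_free_ucycle free uc.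
  by rewrite /fam c3 andTb negb_or -ltnNge => /andP[+ _]; rewrite mulnS subn1.
have noC c : ucycle (adj E) c -> size c != 2 * k.
  by move=> uc; have := cycle_free_ucycle free uc; rewrite /fam negb_or => /andP[].
apply: leq_trans (count_cycles_le E _) _.
apply: leq_trans (card_ucycles _ _ m_gt1) _.
(* The trace bound concerns squares. *)
rewrite -leq_sqr.
case: m m_gt1 => [|[|m]] // _.
apply: leq_trans (trace_power _ m) _.
apply: (@leq_trans ((sum_sqr_const d k * n ^ 2) ^ m.+2)).
  rewrite leq_exp2r // -[X in _ * X ^ 2](card_ord n).
  exact: sum_sqr_nlinks_le (@adj_sym _ E) girth d_gt0 k_gt noC.
rewrite [leqLHS]expnMn [leqRHS]expnMn -(expnM n 2) -(expnM n _ 2) [2 * _]mulnC.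
(* A natural number is at most its square, so the constant needs no root. *)
by apply: leq_mul => //; rewrite -mulnn; case: (_ ^ _) => // x; apply: leq_pmulr.
Qed.

(** * The lower bound *)

Section Ring.
Variables m l : nat.
Hypothesis m_gt1 : 1 < m.
Hypothesis l_gt1 : 1 < l.
Let M := m * l.

(* The vertex x sits at position x %% (m * l) of a cycle of length m * l, in the
   copy x %/ (m * l); the positions divisible by l are hubs, of which only copy 0
   is kept. A non-hub is thus joined to exactly one vertex in each direction. *)
Definition ring_vertex x := (l %| x) ==> (x < m * l).

Definition up x y := [&& ring_vertex x, ring_vertex y, y == x.+1 %[mod m * l] &
  [|| l %| x, l %| y | x %/ (m * l) == y %/ (m * l)]].

Let l_gt0 : 0 < l. Proof. exact: ltnW. Qed.
Let M_gt0 : 0 < M. Proof. by rewrite muln_gt0 l_gt0 ltnW. Qed.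
Let l_dvd_M : l %| M. Proof. exact: dvdn_mull. Qed.

Let hub_mod x y : x = y %[mod M] -> (l %| x) = (l %| y).
Proof. by move=> E; rewrite /dvdn -(modn_dvdm x l_dvd_M) E modn_dvdm. Qed.

(** Residue and copy determine a vertex, and hubs exist in copy 0 only. *)
Let vertex_eq x y : ring_vertex x -> ring_vertex y -> x = y %[mod M] ->
  (l %| x) || (x %/ M == y %/ M) -> x = y.
Proof.
rewrite /ring_vertex => vx vy E H; rewrite (divn_eq x M) (divn_eq y M) -E.
suff -> : x %/ M = y %/ M by [].
case/orP: H => [hx|/eqP-> //]; have hy : l %| y by rewrite -(hub_mod E).
by move: vx vy; rewrite hx hy /= => ltx lty; rewrite !divn_small.
Qed.

Let succ_inj x y : x.+1 = y.+1 %[mod M] -> x = y %[mod M].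
Proof. by move/eqP; rewrite -addn1 -(addn1 y) eqn_modDr => /eqP. Qed.

Let up_inj_l z x y : ~~ (l %| z) -> up x z -> up y z -> x = y.
Proof.
move=> nz /and4P[vx vz /eqP zx cx] /and4P[vy _ /eqP zy cy].
have E : x = y %[mod M] by apply: succ_inj; rewrite -zx.
apply: (vertex_eq vx vy E); move: cx cy; rewrite (negbTE nz) /= -(hub_mod E).
by case: (l %| x) => //= /eqP-> /eqP->.
Qed.

Let up_inj_r z x y : ~~ (l %| z) -> up z x -> up z y -> x = y.
Proof.
move=> nz /and4P[vz vx /eqP xz cx] /and4P[_ vy /eqP yz cy].
have E : x = y %[mod M] by rewrite xz.
apply: (vertex_eq vx vy E); move: cx cy; rewrite (negbTE nz) /= -(hub_mod E).
by case: (l %| x) => //= /eqP<- /eqP<-.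
Qed.

(** A cycle of length [N], unrolled to a periodic sequence so that indices need no wrapping. *)
Variables (c : nat -> nat) (N : nat).
Hypothesis N_gt2 : 2 < N.
Hypothesis c_mod : forall i j, (c i = c j) <-> (i = j %[mod N]).
Hypothesis c_adj : forall i, up (c i) (c i.+1) || up (c i.+1) (c i).

Let s i := up (c i) (c i.+1).
(* Residue of one step along the ring, -1 being represented by M - 1. *)
Let delta b := if b then 1 else M.-1.

Let deltaN b : delta b + delta (~~ b) = M.
Proof. by case: b; rewrite /= ?add1n ?addn1 prednK. Qed.

Let c_vertex i : ring_vertex (c i).
Proof. by case/orP: (c_adj i) => /and4P[]. Qed.

Let hub_eq i j : l %| c i -> c i = c j %[mod M] -> i = j %[mod N].
Proof. by move=> hi E; apply/c_mod; apply: vertex_eq => //; rewrite hi. Qed.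

Let c_step i : c i.+1 = c i + delta (s i) %[mod M].
Proof.
have := c_adj i; rewrite /s.
case: (boolP (up (c i) (c i.+1))) => [/and4P[_ _ /eqP E _] _|_ /= /and4P[_ _ /eqP E _]].
  by rewrite E addn1.
by rewrite -modnDml E modnDml addSnnS prednK // modnDr.
Qed.

(** Turning back at a non-hub would force [c i = c i.+2], impossible as [2 < N]. *)
Let s_step i : ~~ (l %| c i.+1) -> s i.+1 = s i.
Proof.
move=> nh; have neq : c i <> c i.+2.
  move/c_mod/eqP; rewrite -[i.+2]addn2 -{1}[i]addn0 eqn_modDl mod0n.
  by rewrite modn_small.
rewrite /s; move: (c_adj i) (c_adj i.+1).
case: (boolP (up (c i) (c i.+1))) => [u1|_] /=; case: (boolP (up (c i.+1) (c i.+2))) => [u2|_] //= u3 u4.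
  by case: neq; apply: up_inj_l u1 u4.
by case: neq; apply: up_inj_r u3 u2.
Qed.

Let s_const_run h j : (forall i, 0 < i < j -> ~~ (l %| c (h + i))) ->
  (0 < j -> s (h + j.-1) = s h) /\ c (h + j) = c h + j * delta (s h) %[mod M].
Proof.
elim: j => [|j IH] nh; first by rewrite !addn0.
have [|sj cj] := IH; first by move=> i /andP[i0 ij]; apply: nh; rewrite i0 ltnS ltnW.
have E : s (h + j) = s h.
  case: j nh {IH cj} sj => [|j] nh sj; first by rewrite addn0.
  by rewrite addnS s_step -?addnS ?sj // nh // ltnS leqnn.
split=> //=; rewrite addnS c_step E -modnDml cj modnDml mulSn; congr (_ %% _); lia.
Qed.

(** [delta] is 1 or -1 modulo every divisor of [M]. *)
Let dvd_delta n b t : n %| M -> n %| t * delta b -> n %| t.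
Proof.
case: b => /= nM; first by rewrite muln1.
move=> nt; have : n %| t * M by apply: dvdn_mull.
by rewrite -{1}(prednK M_gt0) mulnS dvdn_addl.
Qed.

Let exists_hub : exists h, l %| c h.
Proof.
(* Without hubs the direction is constant, and [t] steps lead to the residue of [c 0 * l] (forward)
   or [c 0 * M] (backward), a hub. *)
pose t := c 0 * (if s 0 then l.-1 else 1).
case: (boolP [exists i : 'I_t.+1, l %| c i]) => [/existsP[i hi]|]; first by exists i.
rewrite negb_exists => /forallP nh.
have [|_] := @s_const_run 0 t.
  by move=> i /andP[_ it]; have := nh (Ordinal (leqW it)).
rewrite !add0n => /hub_mod E; exists t; rewrite E /t /delta.
case: (s 0); rewrite /= !muln1 -mulnS prednK //; first exact: dvdn_mull.
by rewrite (dvdn_trans l_dvd_M) // dvdn_mull.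
Qed.

(** By strong induction the direction is constant up to step [i], so the position has moved by [i]
    up to sign, not a multiple of [l]. *)
Let non_hub h i : l %| c h -> 0 < i < l -> ~~ (l %| c (h + i)).
Proof.
move=> hh; have [n] := ubnP i; elim: n i => // n IH i; rewrite ltnS => i_le /andP[i_gt0 i_lt].
have [|_ /hub_mod ->] := @s_const_run h i.
  move=> j /andP[j_gt0 ji]; apply: IH; first exact: leq_trans ji i_le.
  by rewrite j_gt0 (ltn_trans ji).
rewrite dvdn_addr //; apply/negP => /(dvd_delta l_dvd_M).
by rewrite gtnNdvd.
Qed.

Let run h j : l %| c h -> j <= l -> c (h + j) = c h + j * delta (s h) %[mod M].
Proof.
move=> hh jl; have [|_ ->//] := @s_const_run h j.
by move=> i /andP[i0 ij]; apply: non_hub => //; rewrite i0 (leq_trans ij).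
Qed.

Let next_hub h : l %| c h -> l %| c (h + l).
Proof. by move=> hh; rewrite (hub_mod (run hh (leqnn l))) dvdn_addr // dvdn_mulr. Qed.

(** For [N = l], one full segment would return to its starting hub, forcing [m = 1]; for [N < l],
    the starting hub would recur too early. *)
Let N_gt_l : l < N.
Proof.
have [h hh] := exists_hub; have N_gt0 : 0 < N by apply: ltn_trans N_gt2.
have cN : c (h + N) = c h by apply/c_mod; rewrite modnDr.
rewrite ltn_neqAle; apply/andP; split.
  apply/eqP => lN; have := run hh (leqnn l); rewrite {1}lN cN => /eqP.
  rewrite -{1}[c h]addn0 eqn_modDl mod0n eq_sym -/(dvdn M _) => /dvdnP[x E].
  have : m %| delta (s h) * 1.
    rewrite muln1; apply/dvdnP; exists x; apply/eqP.
    by rewrite -(eqn_pmul2l l_gt0) E /M; apply/eqP; lia.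
  rewrite mulnC => /dvd_delta; rewrite dvdn_mulr // dvdn1 => /(_ isT) /eqP.
  by move=> m1; move: m_gt1; rewrite m1.
rewrite leqNgt; apply/negP => Nl; have := @non_hub h N hh.
by rewrite N_gt0 Nl cN hh => /(_ isT).
Qed.

(* Turning back at a hub leads to the previous hub, closing a cycle of length 2l. *)
Let no_flip h : N <> 2 * l -> l %| c h -> s (h + l) = s h.
Proof.
move=> N2l hh; apply/eqP/negPn/negP => flip.
have flipE : s (h + l) = ~~ s h by move: flip; case: (s _); case: (s _).
have E : c (h + l + l) = c h %[mod M].
  rewrite (run (next_hub hh) (leqnn l)) flipE -modnDml (run hh (leqnn l)) modnDml.
  by rewrite -addnA -mulnDr deltaN addnC modnMDl.
have := hub_eq (next_hub (next_hub hh)) E => /eqP.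
(* Thus [N] divides [2 * l], and [l < N] leaves only [N = 2 * l]. *)
rewrite -addnA -{2}[h]addn0 eqn_modDl mod0n addnn -mul2n -/(dvdn N _) => /dvdnP[[|[|x]] xE].
- by move: xE; rewrite mul0n; lia.
- by apply: N2l; rewrite xE mul1n.
have := N_gt_l; nia.
Qed.

Let far_hub h a : N <> 2 * l -> l %| c h ->
  [/\ s (h + a * l) = s h, c (h + a * l) = c h + a * l * delta (s h) %[mod M] &
    l %| c (h + a * l)].
Proof.
move=> N2l hh; elim: a => [|a [sa ca ha]]; first by rewrite !addn0.
rewrite mulSn [l + _]addnC addnA; split.
- by rewrite no_flip.
- by rewrite (run ha (leqnn l)) -modnDml ca modnDml sa -addnA -mulnDl.
exact: next_hub.
Qed.

(** If no hub reverses the direction, [m] segments lead back to the same hub, so [N] divides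
    [m * l]; conversely the residue recurs after [N] steps, so [m * l] divides [N]. *)
Lemma ring_cycle_size : N = m * l \/ N = 2 * l.
Proof.
case: (N =P 2 * l) => [|N2l]; [by right|left].
have [h hh] := exists_hub; apply/eqP; rewrite eqn_dvd; apply/andP; split.
  have [_ E hM] := @far_hub h m N2l hh.
  have : h + m * l = h %[mod N].
    by apply: (hub_eq hM); rewrite E -/M addnC mulnC modnMDl.
  by move/eqP; rewrite -{2}[h]addn0 eqn_modDl mod0n.
have [sN cN hN] := @far_hub h (N %/ l) N2l hh.
have E : c (h + N) = c h + N * delta (s h) %[mod M].
  rewrite {1}(divn_eq N l) addnA (run hN (ltnW (ltn_pmod _ l_gt0))) -modnDml cN modnDml sN.
  by rewrite -addnA -mulnDl -divn_eq.
have cE : c (h + N) = c h by apply/c_mod; rewrite modnDr.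
move/eqP: E; rewrite cE -{1}[c h]addn0 eqn_modDl mod0n eq_sym -/(dvdn M _).
exact: dvd_delta.
Qed.

End Ring.

(** * The ring graph on [n] vertices *)

Section RingGraph.
Variables m l n : nat.
Hypothesis m_gt1 : 1 < m.
Hypothesis l_gt1 : 1 < l.
Let l_gt0 : 0 < l. Proof. exact: ltnW. Qed.
Let M_gt1 : 1 < m * l. Proof. by rewrite (leq_trans m_gt1) // leq_pmulr. Qed.
Let M_gt0 : 0 < m * l. Proof. exact: ltnW. Qed.

Definition ring_graph : {set {set 'I_n}} :=
  [set S | [exists x : 'I_n, exists y : 'I_n, up m l x y && (S == [set x; y])]].

Let up_neq x y : up m l x y -> x != y.
Proof.
case/and4P=> _ _ /eqP E _; apply: contraTneq M_gt1 => xy; move: E; rewrite -xy => /eqP.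
by rewrite -addn1 -{1}[x]addn0 eqn_modDl mod0n eq_sym -/(dvdn _ _) dvdn1 => /eqP ->.
Qed.

Lemma ring_graph_is_graph : is_graph ring_graph.
Proof.
apply/forall_inP => S; rewrite inE => /existsP[x /existsP[y /andP[/up_neq xy /eqP->]]].
by rewrite cards2 -val_eqE xy.
Qed.

Lemma ring_graph_adj x y : adj ring_graph x y = up m l x y || up m l y x.
Proof.
rewrite /adj inE; apply/existsP/idP => [[u /existsP[v /andP[uv /eqP E]]]|/orP[xy|yx]].
- have := set21 x y; have := set22 x y; rewrite E !inE.
  have := set21 u v; have := set22 u v; rewrite -E !inE.
  by do 4!case/orP => /eqP ?; subst; rewrite ?uv ?orbT //; move: (up_neq uv); rewrite eqxx.
- by exists x; apply/existsP; exists y; rewrite xy eqxx.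
by exists y; apply/existsP; exists x; rewrite yx setUC eqxx.
Qed.

Lemma ring_graph_cycle_size c : ucycle (adj ring_graph) c -> 2 < size c ->
  size c = m * l \/ size c = 2 * l.
Proof.
case: c => // x0 c'; set c := x0 :: c'; set N := size c => /andP[cyc uniq_c] N_gt2.
have N_gt0 : 0 < N by [].
apply: (@ring_cycle_size m l m_gt1 l_gt1 (fun i => nth x0 c (i %% N))) => // [i j|i].
  split=> [/val_inj/eqP|-> //].
  by rewrite nth_uniq ?ltn_pmod // => /eqP.
rewrite -ring_graph_adj -[i.+1]addn1 -modnDml addn1.
by move/cycle_nthP: cyc; apply; rewrite ltn_pmod.
Qed.

(** The possible lengths [m * l] and [2 * l] are at least [2 * l] and differ from [2 * k]. *)
Lemma ring_graph_free k : l < k -> 2 * k != m * l -> cycle_free (fam l k) ring_graph.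
Proof.
move=> k_gt neq; apply/existsP => -[j /andP[Fj /has_cycle_ucycle[c uc]]].
have j_gt2 : 2 < j by move: Fj; rewrite /fam; lia.
have := ring_graph_cycle_size uc; rewrite size_tuple => /(_ j_gt2) sz.
have : 2 * l <= m * l by rewrite leq_pmul2r.
by move: Fj neq; rewrite /fam; lia.
Qed.

Let q := n %/ (m * l).

Let seg_lt (i : 'I_(m * l)) : i %/ l < m. Proof. by rewrite ltn_divLR. Qed.

(** [a] selects the copy used in each segment between consecutive hubs. *)
Let level (a : {ffun 'I_m -> 'I_q}) (i : 'I_(m * l)) : nat :=
  if l %| i then 0 else a (Ordinal (seg_lt i)).

Let vtx_lt a i : level a i * (m * l) + i < n.
Proof.
have lev : level a i <= q.-1.
  rewrite /level; case: ifP => // _; have := ltn_ord (a (Ordinal (seg_lt i))); lia.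
have [q0|q_gt0] := posnP q.
  by have := a (Ordinal (seg_lt i)); rewrite q0 => -[].
apply: leq_trans (leq_trunc_div n (m * l)); rewrite -/q -{1}(prednK q_gt0) mulSn addnC.
have := leq_mul lev (leqnn (m * l)); have := ltn_ord i; lia.
Qed.

Let vtx a i : 'I_n := Ordinal (vtx_lt a i).

Let vtx_mod a i : vtx a i = i %[mod m * l].
Proof. by rewrite /= modnMDl. Qed.

Let vtx_div a i : vtx a i %/ (m * l) = level a i.
Proof. by rewrite /= divnMDl // divn_small ?addn0. Qed.

Let vtx_hub a i : (l %| vtx a i) = (l %| i).
Proof. by rewrite /= dvdn_addr // mulnA dvdn_mull. Qed.

Let vtx_vertex a i : ring_vertex m l (vtx a i).
Proof.
rewrite /ring_vertex vtx_hub; apply/implyP => hi.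
by rewrite /= /level hi mul0n add0n.
Qed.

Let vtx_inj a : injective (vtx a).
Proof.
move=> i j /(congr1 (fun x : 'I_n => x %% (m * l))); rewrite !vtx_mod !modn_small //.
exact: val_inj.
Qed.

Let vtx_up a i : up m l (vtx a i) (vtx a (ordS i)).
Proof.
apply/and4P; split; rewrite ?vtx_vertex //.
  by rewrite -[(vtx a i).+1]addn1 -modnDml !vtx_mod modnDml addn1 modn_mod.
rewrite !vtx_hub !vtx_div; case: (boolP (l %| i)) => //= hi.
case: (boolP (_ %| _)) => //= hS.
(* The ring wraps around only at hub 0. *)
have iS : i.+1 < m * l.
  rewrite ltn_neqAle ltn_ord andbT; apply: contraNneq hS => ->; by rewrite modnn.
rewrite /level (negbTE hi) (negbTE hS : (l %| ordS i) = false).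
rewrite modn_small // in hS.
apply/eqP; congr (nat_of_ord (a _)); apply: val_inj => /=.
by rewrite modn_small // divnS // (negbTE hS).
Qed.

Let ring_cycle a := cyc_edges (finfun (vtx a)).

(** The choice [a i] is read off from the vertex just after the i-th hub, a non-hub since
    [1 < l]. *)
Let ring_cycle_inj : injective ring_cycle.
Proof.
move=> a b E; apply/ffunP => i; apply: val_inj => /=.
have j_lt : i * l + 1 < m * l.
  have := leq_mul (ltn_ord i) (leqnn l); rewrite mulSn; lia.
pose j := Ordinal j_lt.
have hj : ~~ (l %| j) by rewrite /= dvdn_addr ?dvdn_mull // dvdn1 neq_ltn l_gt1 orbT.
have segj : Ordinal (seg_lt j) = i by apply: val_inj; rewrite /= divnMDl // divn_small ?addn0.
have : [set vtx a j; vtx a (ordS j)] \in ring_cycle b.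
  by rewrite -E; apply/imsetP; exists j => //; rewrite !ffunE.
case/imsetP=> t _; rewrite !ffunE => Et.
have : exists t, vtx a j = vtx b t.
  have := set21 (vtx a j) (vtx a (ordS j)); rewrite Et !inE => /orP[]/eqP->; by eexists.
case=> {t Et} t Et.
have jt : j = t.
  move/(congr1 (fun x : 'I_n => x %% (m * l))): (Et); rewrite !vtx_mod !modn_small //.
  exact: val_inj.
move/(congr1 (fun x : 'I_n => x %/ (m * l))): Et; rewrite !vtx_div -jt /level.
by rewrite (negbTE hj) segj.
Qed.

Lemma ring_graph_count : q ^ m <= count_cycles (m * l) ring_graph.
Proof.
have -> : q ^ m = #|[set ring_cycle a | a : {ffun 'I_m -> 'I_q}]|.
  by rewrite card_imset // card_ffun !card_ord.
apply/subset_leq_card/subsetP => S /imsetP[a _ ->]; rewrite inE powersetE.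
apply/andP; split.
  apply/subsetP => s /imsetP[i _ ->]; rewrite !ffunE.
  by rewrite -[_ \in _]/(adj ring_graph _ _) ring_graph_adj vtx_up.
apply/existsP; exists (finfun (vtx a)); rewrite eqxx andbT.
by apply/injectiveP => i j; rewrite !ffunE => /vtx_inj.
Qed.
End RingGraph.

(** * The two bounds combined *)

Lemma ex_cycle_ge m l k n : 1 < m -> 1 < l -> l < k -> 2 * k != m * l ->
  (n %/ (m * l)) ^ m <= ex_cycle n (m * l) (fam l k).
Proof.
move=> m_gt1 l_gt1 k_gt neq; apply: leq_trans (ring_graph_count n m_gt1 l_gt1) _.
apply: leq_bigmax_cond; rewrite ring_graph_is_graph //.
exact: ring_graph_free.
Qed.

Lemma ex_cycle_le m l k n : 1 < m -> 1 < l -> l < k ->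
  ex_cycle n (m * l) (fam l k) <= sum_sqr_const l.-1 k ^ m * n ^ m.
Proof.
move=> m_gt1 l_gt1 k_gt; apply/bigmax_leqP => E /andP[_ free].
exact: count_cycles_fam_le.
Qed.

Import Order.TTheory GRing.Theory Num.Theory.
Local Open Scope ring_scope.
Unset Implicit Arguments.
Set Strict Implicit.

Theorem theorem11 (l k m : nat) :
  (2 <= l)%N -> (l < k)%N -> (2 <= m)%N -> (2 * k != m * l)%N ->
  exists c1 c2 : rat, 0 < c1 /\ 0 < c2 /\
    exists N : nat, forall n : nat, (N <= n)%N ->
      c1 * (n%:R) ^+ m <= (ex_cycle n (m * l) (fam l k))%:R /\
      (ex_cycle n (m * l) (fam l k))%:R <= c2 * (n%:R) ^+ m.
Proof.
move=> l_gt1 k_gt m_gt1 neq.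
have M_gt0 : (0 < m * l)%N by rewrite muln_gt0; lia.
pose C := (sum_sqr_const l.-1 k ^ m)%N.
have C_gt0 : (0 < C)%N by rewrite expn_gt0 /sum_sqr_const; lia.
(* For [n >= m * l], rounding down loses at most a factor 2 in [n %/ (m * l)]. *)
exists ((2 * (m * l)) ^ m)%N%:R^-1, C%:R.
split; first by rewrite invr_gt0 ltr0n expn_gt0; lia.
split; first by rewrite ltr0n.
exists (m * l)%N => n n_ge; split; last first.
  by rewrite -natrX -natrM ler_nat; apply: ex_cycle_le.
rewrite mulrC ler_pdivrMr ?ltr0n ?expn_gt0; last by lia.
rewrite -natrX -natrM ler_nat.
apply: leq_trans (leq_mul (ex_cycle_ge n m_gt1 l_gt1 k_gt neq) (leqnn _)).
rewrite -expnMn leq_exp2r; last exact: ltnW.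
have q_gt0 : (0 < n %/ (m * l))%N by rewrite divn_gt0.
rewrite {1}(divn_eq n (m * l)); have := ltn_pmod n M_gt0.
move: q_gt0; set q := (n %/ _)%N; set r := (n %% _)%N; set M := (m * l)%N.
case: q => // q _ r_lt; rewrite mulnCA mul2n -addnn leq_add2l.
by apply: leq_trans (ltnW r_lt) _; rewrite leq_pmull.
Qed.
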